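(* Let $A(\varepsilon)=[a_{i,j}(\varepsilon)]_{1\le i,j\le m}$ and $B(\varepsilon)=[b_{i,j}(\varepsilon)]_{1\le i,j\le m}$ be $m$-by-$m$ real symmetric matrices depending on a real parameter $\varepsilon>0$ ($\varepsilon$ small enough) such that, as $\varepsilon\to0$, for all $1\le i,j\le m$, $$a_{i,j}(\varepsilon)=\hat a^{(0)}_{i,j}\,\varepsilon^{\ell_i+\ell_j}+o\left(\varepsilon^{\ell_i+\ell_j}\right),\qquad b_{i,j}(\varepsilon)=\delta_{i,j}+o(1),$$ where $\{\ell_j\}_{j=1}^m$ is a non-increasing sequence of positive integers and $\hat A_0=[\hat a^{(0)}_{i,j}]_{1\le i,j\le m}$ is a real, symmetric and positive-definite matrix. For $\varepsilon$ small enough, let $\{\mu_j(\varepsilon)\}_{j=1}^m$ be the (real) eigenvalues of the problem $A(\varepsilon)\xi=\mu\,B(\varepsilon)\xi$, $\xi\in\mathbb R^m$, counted with multiplicities and arranged in non-decreasing order. Let $k_1>\dots>k_p$ be the distinct values taken by $\{\ell_j\}_{j=1}^m$ and $m_1,\dots,m_p$ the corresponding multiplicities (so $m=m_1+\dots+m_p$, and $\ell_s=k_i$ for $m_1+\dots+m_{i-1}+1\le s\le m_1+\dots+m_i$). Let $(\hat D_0,\hat L_0)$ be the Gram-Schmidt pair associated with $\hat A_0$, with $\hat D_0=[d^{(0)}_{s,t}]_{1\le s,t\le m}$ and $\hat L_0=[l^{(0)}_{s,t}]_{1\le s,t\le m}$. For each $1\le i\le p$, define the $m_i$-by-$m_i$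 matrices $$\hat D_i^{(0)}=[d^{(0)}_{s,t}]_{m_1+\dots+m_{i-1}+1\le s,t\le m_1+\dots+m_i},\quad \hat L_i^{(0)}=[l^{(0)}_{s,t}]_{m_1+\dots+m_{i-1}+1\le s,t\le m_1+\dots+m_i},\quad \hat Q_i^{(0)}=\left(\hat L_i^{(0)}\right)^T\hat L_i^{(0)},$$ and let $\{\hat\mu^{(0)}_{i,j}\}_{j=1}^{m_i}$ be the eigenvalues of the problem $\hat D_i^{(0)}\xi=\mu\,\hat Q_i^{(0)}\xi$, $\xi\in\mathbb R^{m_i}$, counted with multiplicities and arranged in non-decreasing order. Then, as $\varepsilon\to0$, $$\mu_{m_1+\dots+m_{i-1}+j}(\varepsilon)=\hat\mu^{(0)}_{i,j}\,\varepsilon^{2k_i}+o\left(\varepsilon^{2k_i}\right)\quad\text{for all }1\le i\le p\text{ and }1\le j\le m_i.$$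
   Context: Gram-Schmidt pair: for a real, symmetric, positive-definite $m$-by-$m$ matrix $A$, there is a unique pair $(D,L)$ of real $m$-by-$m$ matrices such that $D$ is diagonal, $L$ is lower-triangular with all diagonal coefficients equal to $1$, and $D=L^TAL$; this pair is called the Gram-Schmidt pair associated with $A$. $\delta_{i,j}$ is the Kronecker symbol. *)

(* Defs.v *)
From mathcomp Require Import all_boot all_order all_algebra.
From mathcomp Require Import all_classical all_reals all_analysis.

Set Implicit Arguments.
Unset Strict Implicit.
Unset Printing Implicit Defensive.

Import Order.TTheory GRing.Theory Num.Theory.
Import numFieldNormedType.Exports.

Local Open Scope ring_scope.

Definition posdefmx (R : realFieldType) (n : nat) (A : 'M[R]_n) : Prop :=
  forall v : 'cV[R]_n, v != 0 -> 0 < (v^T *m A *m v) 0 0.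

(* [is_trig_mx L] says that the entries above the diagonal vanish, that is,
   L is lower-triangular. *)
Definition Gram_Schmidt_pair (R : realFieldType) (n : nat)
    (A D L : 'M[R]_n) : Prop :=
  [/\ is_diag_mx D, is_trig_mx L, forall i, L i i = 1 & D = L^T *m A *m L].

(* The row space of this matrix consists of the transposes of the columns xi
   such that A *m xi = x *: (B *m xi): see [pencil_eigenspaceP]. *)
Definition pencil_eigenspace (R : fieldType) (n : nat) (A B : 'M[R]_n) (x : R) :
  'M[R]_n := kermx (A - x *: B)^T.

Lemma pencil_eigenspaceP (R : fieldType) (n : nat) (A B : 'M[R]_n) (x : R)
    (xi : 'cV[R]_n) :
  reflect (A *m xi = x *: (B *m xi)) (xi^T <= pencil_eigenspace A B x)%MS.
Proof.
apply: (iffP sub_kermxP) => [/(congr1 trmx)|E].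
  by rewrite -trmx_mul trmxK trmx0 mulmxBl -scalemxAl => /eqP; rewrite subr_eq0 => /eqP.
by rewrite -trmx_mul mulmxBl -scalemxAl E subrr trmx0.
Qed.

(* mu lists the eigenvalues of A xi = x B xi in non-decreasing order, each
   repeated according to the dimension of its eigenspace. For A symmetric and B
   symmetric positive definite, such a mu exists and is unique. *)
Definition ordered_eigenvalues (R : realFieldType) (n : nat) (A B : 'M[R]_n)
    (mu : 'I_n -> R) : Prop :=
  (forall i j : 'I_n, (i <= j)%N -> mu i <= mu j) /\
  (forall x : R, #|[set j | mu j == x]| = \rank (pencil_eigenspace A B x)).

Section Blocks.
Variables (p m : nat) (mult : 'I_p -> nat).
Hypothesis hm : (\sum_i mult i)%N = m.

Definition block_index (i : 'I_p) (j : 'I_(mult i)) : 'I_m :=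
  cast_ord hm (tagnat.Rank i j).

Lemma block_indexE (i : 'I_p) (j : 'I_(mult i)) :
  block_index j = (\sum_(i' < p | (i' < i)%N) mult i' + j)%N :> nat.
Proof. exact: tagnat.RankEsum. Qed.

Definition diag_block (T : Type) (M : 'M[T]_m) (i : 'I_p) : 'M[T]_(mult i) :=
  mxsub (@block_index i) (@block_index i) M.

End Blocks.

(* Main.v *)
Require Import Defs.
From mathcomp Require Import all_boot all_order all_algebra.
From mathcomp Require Import all_classical all_reals all_analysis.
From mathcomp Require Import ring zify.

(** The proof counts eigenvalues by inertia, so that only the openness of
positive definiteness has to be passed to the limit.

For a symmetric pencil (A, B) with B positive definite, let V be any matrix
with r rows. If V (A - c B) V^T is positive definite then at least r eigenvalues
exceed c, because the sum of the eigenspaces of the eigenvalues at most c meets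
the row space of V trivially ([leq_card_eigenvalues_gt]); and such a V with as
many rows as there are eigenvalues above c exists ([posdef_eigenvalues_gt]).
Replacing A by - A gives the same for the eigenvalues below c. In a sorted list,
these two counts decide whether a given eigenvalue is above or below c
([sorted_ltE], [sorted_gtE]).

Fix a value k of the sequence ell and rescale the s-th coordinate by
e ^- min(ell s, k). The pencil (A e, e^(2k) B e) then converges entrywise
([cvg_scaled_pencil]) to the pencil (A', B') where A' is A0 restricted to the
coordinates with ell s <= k, and B' is the identity restricted to those with
ell s >= k. Although B' is singular, the counts survive the limit: if
V (A' - c B') V^T is positive definite, then so is the rescaled form for small
e, which bounds below the number of eigenvalues of (A e, B e) above
c e^(2k); likewise below c e^(2k).

It remains to exhibit V for the limit pencil. On the coordinates with
ell s <= k, the change of coordinates L0 turns A0 into D0, so A' - c B' splits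
as a direct sum: - c on the coordinates with ell s > k, the form Dh - c Lh^T Lh
on those with ell s = k, where Dh and Lh are the diagonal blocks of D0 and L0,
and a positive diagonal form on those with ell s < k
([limit_pencil_posdef], [limit_pencil_negdef]). Together with eigenvectors of
the block pencil, this gives the two bounds
c e^(2k) < mu < c' e^(2k) for all c < muhat < c', which is the asserted
expansion. *)

Set Implicit Arguments.
Unset Strict Implicit.
Unset Printing Implicit Defensive.

Import Order.TTheory GRing.Theory Num.Theory.
Import numFieldNormedType.Exports.

Local Open Scope classical_set_scope.
Local Open Scope ring_scope.

Lemma symmetricmx_tr (R : realFieldType) n (A : 'M[R]_n) :
  A \is symmetricmx -> A^T = A.
Proof.
by rewrite is_hermitianmxE expr0 scale1r map_mx_id // => /eqP/esym.
Qed.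

(** * Positive definite forms *)

Section PositiveDefinite.
Variable R : realFieldType.

Lemma posdefmx_row n (A : 'M[R]_n) (u : 'rV[R]_n) :
  posdefmx A -> u != 0 -> 0 < (u *m A *m u^T) 0 0.
Proof.
move=> Apos u0; rewrite -{1}[u]trmxK; apply: Apos.
by rewrite -trmx0 (inj_eq (@trmx_inj _ _ _)).
Qed.

Lemma posdefmx_ge0 n (A : 'M[R]_n) (u : 'rV[R]_n) :
  posdefmx A -> 0 <= (u *m A *m u^T) 0 0.
Proof.
move=> Apos; have [->|u0] := eqVneq u 0; first by rewrite !mul0mx mxE.
exact/ltW/posdefmx_row.
Qed.

Lemma posdefmx_congr m n (A : 'M[R]_n) (M : 'M[R]_(m, n)) :
  posdefmx A -> row_free M -> posdefmx (M *m A *m M^T).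
Proof.
move=> Apos Mfree v v0.
have := @posdefmx_row _ A (v^T *m M) Apos.
rewrite mulmx_free_eq0 // -trmx0 (inj_eq (@trmx_inj _ _ _)) => /(_ v0).
by rewrite trmx_mul trmxK !mulmxA.
Qed.

Lemma posdefmx_row_free m n (A : 'M[R]_n) (M : 'M[R]_(m, n)) :
  posdefmx (M *m A *m M^T) -> row_free M.
Proof.
move=> MAM; rewrite -kermx_eq0; apply/rowV0P => v /sub_kermxP vM0.
apply: contraTeq (isT) => /(posdefmx_row MAM).
by rewrite !mulmxA vM0 !mul0mx mxE ltxx.
Qed.

Lemma posdefmx_unitmx n (A : 'M[R]_n) : posdefmx A -> A \in unitmx.
Proof.
move=> Apos; rewrite -row_free_unit -kermx_eq0; apply/rowV0P => v /sub_kermxP vA0.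
apply: contraTeq (isT) => /(posdefmx_row Apos).
by rewrite vA0 mul0mx mxE ltxx.
Qed.

Lemma posdefmx_block m n (A : 'M[R]_m) (D : 'M[R]_n) :
  posdefmx A -> posdefmx D -> posdefmx (block_mx A 0 0 D).
Proof.
move=> Apos Dpos v v0; rewrite -[v]trmxK in v0 *; set u := v^T in v0 *.
rewrite trmxK -[u]hsubmxK tr_row_mx mul_row_block !mulmx0 addr0 add0r.
rewrite mul_row_col mxE.
have [l0|l0] := eqVneq (lsubmx u) 0.
  rewrite l0 !mul0mx mxE add0r; apply: posdefmx_row => //.
  apply: contraNneq v0 => r0.
  by rewrite -trmx0 (inj_eq (@trmx_inj _ _ _)) -[u]hsubmxK l0 r0 row_mx0.
by rewrite ltr_wpDr ?posdefmx_ge0 ?posdefmx_row.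
Qed.

Lemma posdefmx_scalar n (a : R) : 0 < a -> posdefmx (a%:M : 'M[R]_n).
Proof.
move=> a0 v v0; rewrite mul_mx_scalar -scalemxAl mxE mulr_gt0 //.
rewrite mxE lt_neqAle eq_sym sumr_ge0 ?andbT; last first.
  by move=> i _; rewrite mxE -expr2 sqr_ge0.
apply: contraNneq v0 => /eqP; rewrite psumr_eq0; last first.
  by move=> i _; rewrite mxE -expr2 sqr_ge0.
move=> /allP v0; apply/eqP/colP => i; rewrite mxE.
by apply/eqP; have := v0 i (mem_index_enum _); rewrite mxE mulf_eq0 orbb.
Qed.

End PositiveDefinite.

(** * Counting the eigenvalues of a symmetric pencil *)

Section EigenvalueCounting.
Variable R : realFieldType.

(** The unordered half of [ordered_eigenvalues]: unlike the ordering, it is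
stable under the change of sign of A used to pass from counts above c to counts
below c. *)
Definition eigenvalue_family n (A B : 'M[R]_n) (mu : 'I_n -> R) :=
  forall x : R, #|[set j | mu j == x]%SET| = \rank (pencil_eigenspace A B x).

Lemma eigenvalue_familyN n (A B : 'M[R]_n) mu :
  eigenvalue_family A B mu -> eigenvalue_family (- A) B (fun j => - mu j).
Proof.
move=> muP x; have NE : - A - x *: B = - (A - (- x) *: B).
  by rewrite scaleNr opprK opprD.
have -> : \rank (pencil_eigenspace (- A) B x) = \rank (pencil_eigenspace A B (- x)).
  by rewrite /pencil_eigenspace !mxrank_ker !mxrank_tr NE mxrank_opp.
by rewrite -muP; apply: eq_card => j; rewrite !inE eqr_oppLR.
Qed.

Variables (n : nat) (A B : 'M[R]_n) (mu : 'I_n -> R).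
Hypotheses (Asym : A^T = A) (Bsym : B^T = B) (Bpos : posdefmx B).
Hypothesis muP : eigenvalue_family A B mu.

Lemma sub_pencil_eigenspace x m (u : 'M[R]_(m, n)) :
  (u <= pencil_eigenspace A B x)%MS = (u *m A == x *: (u *m B)).
Proof.
rewrite /pencil_eigenspace linearB linearZ /= Asym Bsym.
by rewrite sub_kermx mulmxBr -scalemxAr subr_eq0.
Qed.

(** The eigenspaces are those of the matrix A B^-1, hence in direct sum, which
gives the rank of their sum W. Symmetry makes eigenvectors of distinct
eigenvalues orthogonal for B, so that A - c B is diagonal along the
decomposition. *)
Lemma eigenvector_expansion (T : pred R) : exists2 W : 'M[R]_n,
  \rank W = #|[pred j | T (mu j)]| &
  forall v : 'rV[R]_n, (v <= W)%MS ->
  exists2 u : seq_sub (codom mu) -> 'rV[R]_n, v = \sum_(x | T (val x)) u x &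
  forall c : R, (v *m (A - c *: B) *m v^T) 0 0 =
    \sum_(x | T (val x)) (val x - c) * (u x *m B *m (u x)^T) 0 0.
Proof.
have Bunit := posdefmx_unitmx Bpos.
pose E (x : seq_sub (codom mu)) := pencil_eigenspace A B (val x).
have EE x : (E x :=: eigenspace (A *m invmx B) (val x))%MS.
  apply/eqmxP/rV_eqP => u; rewrite sub_pencil_eigenspace.
  apply/eqP/eigenspaceP => [uA|uA].
    by rewrite mulmxA uA -scalemxAl mulmxK.
  by rewrite scalemxAl -uA mulmxA mulmxKV.
exists (\sum_(x | T (val x)) E x)%MS.
  rewrite (eqmx_sums (fun x _ => EE x)).
  have /mxdirectP -> := mxdirect_sum_eigenspace (A *m invmx B)
    (P := fun x : seq_sub (codom mu) => T (val x)) (in2W val_inj).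
  rewrite /= (eq_bigr (fun x => #|[set j | mu j == val x]%SET|)); last first.
    by move=> x _; rewrite -EE -muP.
  (* f sorts the indices j by eigenvalue. *)
  pose f j : seq_sub (codom mu) := SeqSub (codom_f mu j).
  rewrite -sum1_card (partition_big f (fun x => T (val x))) //=.
  apply: eq_bigr => x Tx; rewrite -sum1_card; apply: eq_bigl => j.
  rewrite !inE -(inj_eq val_inj) /=.
  by case: eqP => [->|]; rewrite ?Tx ?andbF.
move=> v /sub_sumsmxP[w vw]; exists (fun x => w x *m E x) => // c.
have uA x : w x *m E x *m A = val x *: (w x *m E x *m B).
  by apply/eqP; rewrite -sub_pencil_eigenspace submxMl.
have orth x y : x != y -> (w x *m E x) *m B *m (w y *m E y)^T = 0.
  move: (uA x) (uA y); move: (w x *m E x) (w y *m E y) => a b aA bA xy.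
  apply/eqP; rewrite -[_ == 0]orFb.
  have /negPf <- : val x - val y != 0 by rewrite subr_eq0 (inj_eq val_inj).
  rewrite -scaler_eq0 scalerBl scalemxAl -aA -[X in _ - _ *: X]mulmxA.
  rewrite -{1}Bsym -trmx_mul scalemxAr -linearZ /= -bA trmx_mul Asym.
  by rewrite mulmxA subrr.
rewrite vw linear_sum /= mulmx_suml mulmx_suml summxE; apply: eq_bigr => x Tx.
rewrite mulmx_sumr (bigD1 x) //= big1 ?addr0 => [|y /andP[_ yx]].
  by rewrite mulmxBr uA -scalemxAr -scalerBl -scalemxAl mxE.
rewrite mulmxBr uA -scalemxAr -scalerBl -scalemxAl orth ?scaler0 //.
by rewrite eq_sym.
Qed.

(** On the eigenspaces of the eigenvalues above c, every coefficient x - c of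
the expansion is positive. *)
Lemma posdef_eigenvalues_gt c : exists r (W : 'M[R]_(r, n)),
  r = #|[pred j | c < mu j]| /\ posdefmx (W *m (A - c *: B) *m W^T).
Proof.
have [W rW WP] := eigenvector_expansion (fun x => c < x).
exists (\rank W), (row_base W); split=> // v v0.
have {}v0 : v^T *m row_base W != 0.
  rewrite mulmx_free_eq0 ?row_base_free //.
  by rewrite -trmx0 (inj_eq (@trmx_inj _ _ _)).
have /WP[u vu uP] : (v^T *m row_base W <= W)%MS.
  by rewrite (submx_trans (submxMl _ _)) ?eq_row_base.
have -> : v^T *m (row_base W *m (A - c *: B) *m (row_base W)^T) *m v =
    (v^T *m row_base W) *m (A - c *: B) *m (v^T *m row_base W)^T.
  by rewrite [in RHS]trmx_mul trmxK !mulmxA.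
have ge0 (x : seq_sub (codom mu)) : c < val x ->
    0 <= (val x - c) * (u x *m B *m (u x)^T) 0 0.
  by move=> cx; rewrite mulr_ge0 ?posdefmx_ge0 // subr_ge0 ltW.
rewrite uP lt_neqAle sumr_ge0 // andbT eq_sym.
apply: contraNneq v0 => /eqP; rewrite psumr_eq0 // => /allP u0.
rewrite vu big1 // => x cx; apply: contraTeq (u0 x (mem_index_enum _)) => ux.
by rewrite cx /= mulf_neq0 ?gt_eqF ?posdefmx_row // subr_gt0.
Qed.

(** A - c B is nonpositive on the sum W of the eigenspaces of the eigenvalues
at most c, hence W meets the row space of V trivially, and r <= n - \rank W. *)
Lemma leq_card_eigenvalues_gt r (V : 'M[R]_(r, n)) c :
  posdefmx (V *m (A - c *: B) *m V^T) -> (r <= #|[pred j | (c < mu j)%R]|)%N.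
Proof.
move=> Vpos; have Vfree := posdefmx_row_free Vpos.
have [W rW WP] := eigenvector_expansion (fun x => x <= c).
have VW0 : (V :&: W = 0)%MS.
  apply/eqP/rowV0P => v; rewrite sub_capmx => /andP[/submxP[w vw] /WP[u _ uP]].
  apply: contraTeq (isT) => v0.
  have w0 : w != 0 by apply: contraNneq v0 => w0; rewrite vw w0 mul0mx.
  have := posdefmx_row Vpos w0.
  rewrite (_ : _ *m _ *m _ = v *m (A - c *: B) *m v^T); last first.
    by rewrite vw trmx_mul !mulmxA.
  rewrite uP ltNge sumr_le0 // => x xc.
  by rewrite mulr_le0_ge0 ?posdefmx_ge0 // subr_le0.
have := mxrank_sum_cap V W; rewrite VW0 mxrank0 addn0 (eqP Vfree) rW => rVW.
rewrite -(leq_add2r #|[pred j | (mu j <= c)%R]|) -rVW.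
rewrite (leq_trans (rank_leq_col _)) // -{1}[n]card_ord -(cardC [pred j | (c < mu j)%R]).
by rewrite leq_add2l; apply/eq_leq/eq_card => j; rewrite !inE leNgt.
Qed.

End EigenvalueCounting.

Section EigenvalueCountingBelow.
Variables (R : realFieldType) (n : nat) (A B : 'M[R]_n) (mu : 'I_n -> R).
Hypotheses (Asym : A^T = A) (Bsym : B^T = B) (Bpos : posdefmx B).
Hypothesis muP : eigenvalue_family A B mu.

Let NAsym : (- A)^T = - A. Proof. by rewrite linearN /= Asym. Qed.

Let NpencilE c : - A - (- c) *: B = c *: B - A.
Proof. by rewrite scaleNr opprK addrC. Qed.

Let card_ltN c : #|[pred j | - c < - mu j]| = #|[pred j | mu j < c]|.
Proof. by apply: eq_card => j; rewrite !inE ltrN2. Qed.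

Lemma posdef_eigenvalues_lt c : exists r (W : 'M[R]_(r, n)),
  r = #|[pred j | mu j < c]| /\ posdefmx (W *m (c *: B - A) *m W^T).
Proof.
have [r [W]] := posdef_eigenvalues_gt NAsym Bsym Bpos (eigenvalue_familyN muP) (- c).
by rewrite card_ltN NpencilE; exists r, W.
Qed.

Lemma leq_card_eigenvalues_lt r (V : 'M[R]_(r, n)) c :
  posdefmx (V *m (c *: B - A) *m V^T) -> (r <= #|[pred j | (mu j < c)%R]|)%N.
Proof.
rewrite -NpencilE -card_ltN.
exact: (leq_card_eigenvalues_gt NAsym Bsym Bpos (eigenvalue_familyN muP)).
Qed.

End EigenvalueCountingBelow.

(** * Sorted families *)

Section Ordering.

Lemma card_ord_lt n a : (a <= n)%N -> #|[pred i : 'I_n | (i < a)%N]| = a.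
Proof.
move=> an; rewrite -sum1_card (big_ord_narrow an).
by rewrite sum_nat_const card_ord muln1.
Qed.

(** Used both for sorted eigenvalues and for the level sets of ell. *)
Lemma initial_segmentE n (P : pred 'I_n) :
  (forall i j : 'I_n, (i <= j)%N -> P j -> P i) ->
  forall j, P j = (j < #|P|)%N.
Proof.
move=> Pinit j; apply/idP/idP => [Pj|].
  rewrite -[X in (X <= _)%N](card_ord_lt (ltn_ord j)).
  by apply/subset_leq_card/fintype.subsetP => i; rewrite inE ltnS => /Pinit; apply.
apply: contraLR => NPj; rewrite -leqNgt -[X in (_ <= X)%N](card_ord_lt (ltnW (ltn_ord j))).
apply/subset_leq_card/fintype.subsetP => i Pi; rewrite inE ltnNge.
by apply: contraNN NPj => /Pinit; apply.
Qed.

Variables (R : realFieldType) (n : nat) (mu : 'I_n -> R).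
Hypothesis mu_ndecr : forall i j : 'I_n, (i <= j)%N -> mu i <= mu j.

Lemma sorted_ltE j c : (mu j < c) = (j < #|[pred i | (mu i < c)%R]|)%N.
Proof.
apply: (@initial_segmentE n (fun i => mu i < c)) => i i' ii'.
exact/le_lt_trans/mu_ndecr.
Qed.

Lemma sorted_gtE j c : (c < mu j) = (n - j <= #|[pred i | (c < mu i)%R]|)%N.
Proof.
rewrite ltNge (@initial_segmentE n (fun i => mu i <= c)) => [|i i' ii'].
  rewrite -leqNgt leq_subLR -[X in _ = (X <= _)%N]card_ord.
  rewrite -(cardC [pred i | mu i <= c]) addnC [in RHS]addnC.
  rewrite (@eq_card _ [predC _] [pred i | c < mu i]) ?leq_add2r // => i.
  by rewrite !inE ltNge.
exact/le_trans/mu_ndecr.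
Qed.

End Ordering.

(** * The limit pencil at a given scale *)

Section LimitPencil.
Variables (R : realFieldType) (m : nat) (ell : 'I_m -> nat) (A0 : 'M[R]_m).
Variable k : nat.

(** [limit_stiffness] and [limit_mass] are the entrywise limits, as e tends to
0, of A e and e^(2k) B e once the s-th coordinate is scaled by
e ^- min(ell s, k). *)
Definition limit_stiffness : 'M[R]_m :=
  \matrix_(s, t) (A0 s t *+ ((ell s <= k) && (ell t <= k))%N).

Definition limit_mass : 'M[R]_m := \matrix_(s, t) ((s == t) && (k <= ell s)%N)%:R.

Local Notation Alim := limit_stiffness.
Local Notation Blim := limit_mass.

Lemma limit_stiffness_tr : A0^T = A0 -> Alim^T = Alim.
Proof.
move=> A0sym; apply/matrixP => s t; rewrite !mxE.
by rewrite -[in LHS]A0sym mxE andbC.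
Qed.

Lemma limit_mass_tr : Blim^T = Blim.
Proof.
by apply/matrixP => s t; rewrite !mxE eq_sym; case: eqP => //= ->.
Qed.

Lemma mul_limit_stiffness a b (X : 'M[R]_(a, m)) (Y : 'M[R]_(b, m)) :
  (forall i s, (k < ell s)%N -> X i s = 0) ->
  (forall i s, (k < ell s)%N -> Y i s = 0) ->
  X *m Alim *m Y^T = X *m A0 *m Y^T.
Proof.
move=> X0 Y0; apply/matrixP => i j; rewrite !mxE; apply: eq_bigr => t _.
rewrite !mxE; have [tk|tk] := leqP (ell t) k; last by rewrite Y0 ?mulr0.
congr (_ * _); apply: eq_bigr => s _.
by have [sk|sk] := leqP (ell s) k; rewrite mxE ?sk ?tk // X0 ?mul0r.
Qed.

Lemma mul_limit_stiffness0 a (X : 'M[R]_(a, m)) :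
  (forall i s, (ell s <= k)%N -> X i s = 0) -> X *m Alim = 0.
Proof.
move=> X0; apply/matrixP => i j; rewrite !mxE big1 // => s _.
have [sk|sk] := leqP (ell s) k; first by rewrite X0 ?mul0r.
by rewrite mxE leqNgt sk mulr0.
Qed.

Lemma mul_limit_mass a (X : 'M[R]_(a, m)) :
  X *m Blim = \matrix_(i, s) (X i s *+ (k <= ell s)%N).
Proof.
apply/matrixP => i s; rewrite !mxE (bigD1 s) //= big1 ?addr0 => [|t ts].
  by rewrite !mxE eqxx mulr_natr.
by rewrite mxE (negPf ts) mulr0.
Qed.

Definition selectmx r (f : 'I_r -> 'I_m) : 'M[R]_(r, m) :=
  \matrix_(i, s) (f i == s)%:R.

Lemma mul_selectmx r (f : 'I_r -> 'I_m) q (M : 'M[R]_(m, q)) :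
  selectmx f *m M = rowsub f M.
Proof.
apply/matrixP => i j; rewrite !mxE (bigD1 (f i)) //= big1 ?addr0 => [|s sf].
  by rewrite mxE eqxx mul1r.
by rewrite mxE eq_sym (negPf sf) mul0r.
Qed.

Lemma mul_tr_selectmx r (f : 'I_r -> 'I_m) q (M : 'M[R]_(q, m)) :
  M *m (selectmx f)^T = colsub f M.
Proof.
rewrite -[M]trmxK -trmx_mul mul_selectmx.
by apply/matrixP => i j; rewrite !mxE.
Qed.

Lemma selectmx_free r (f : 'I_r -> 'I_m) : injective f -> row_free (selectmx f).
Proof.
move=> f_inj; apply/row_freeP; exists (selectmx f)^T.
rewrite mul_tr_selectmx; apply/matrixP => i j.
by rewrite !mxE (inj_eq f_inj).
Qed.

(** Gluing of two subspaces that are orthogonal for S. *)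
Lemma posdefmx_col_mx a b (S : 'M[R]_m) (X : 'M[R]_(a, m)) (Y : 'M[R]_(b, m)) :
  S^T = S -> X *m S *m Y^T = 0 ->
  posdefmx (X *m S *m X^T) -> posdefmx (Y *m S *m Y^T) ->
  posdefmx (col_mx X Y *m S *m (col_mx X Y)^T).
Proof.
move=> Ssym XY Xpos Ypos; rewrite tr_col_mx mul_col_mx mul_col_row XY.
have -> : Y *m S *m X^T = 0.
  by apply: trmx_inj; rewrite !trmx_mul trmxK Ssym mulmxA XY trmx0.
exact: posdefmx_block.
Qed.

Hypothesis ell_noninc : forall s t : 'I_m, (s <= t)%N -> (ell t <= ell s)%N.
Hypotheses (A0sym : A0^T = A0) (A0pos : posdefmx A0).
Variables D0 L0 : 'M[R]_m.
Hypothesis DL0 : Gram_Schmidt_pair A0 D0 L0.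

(** Since ell is non-increasing, v |-> v *m L0^T preserves the space of the row
vectors supported where ell <= k. *)
Lemma Gram_Schmidt_lower0 s t : (ell t < ell s)%N -> L0 s t = 0.
Proof.
move=> ts; have [_ /is_trig_mxP L0trig _ _] := DL0; apply: L0trig.
by rewrite ltnNge; apply: contraL ts => /ell_noninc; rewrite -leqNgt.
Qed.

Lemma Gram_Schmidt_tr_unitmx : L0^T \in unitmx.
Proof.
have [_ L0trig L01 _] := DL0.
by rewrite unitmx_tr unitmxE det_trig // big1 ?unitr1.
Qed.

Variables (n : nat) (h : 'I_n -> 'I_m).
Hypotheses (ell_h : forall j, ell (h j) = k).
Hypothesis h_onto : forall s, ell s = k -> exists j, s = h j.
Hypothesis h_inj : injective h.

Let Dh := mxsub h h D0.
Let Lh := mxsub h h L0.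
Let Mid := selectmx h *m L0^T.

Let MidE j s : Mid j s = L0 s (h j).
Proof. by rewrite /Mid mul_selectmx !mxE. Qed.

Let Mid0 j s : (k < ell s)%N -> Mid j s = 0.
Proof. by move=> ks; rewrite MidE Gram_Schmidt_lower0 // ell_h. Qed.

(** Restricted to the coordinates with ell = k, the rows selected by h in L0^T
form the block Lh^T; the other coordinates with ell >= k vanish. *)
Let Mid_mass : Mid *m Blim = Lh^T *m selectmx h.
Proof.
rewrite mul_limit_mass; apply/matrixP => j s; rewrite mxE [RHS]mxE.
have [[j' ->]|Nh] := pselect (exists j', s = h j').
  rewrite ell_h leqnn MidE mulr1n (bigD1 j') //= big1 ?addr0 => [|i ij'].
    by rewrite !mxE eqxx mulr1.
  by rewrite !mxE (inj_eq h_inj) (negPf ij') mulr0.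
rewrite big1 => [|j' _]; last first.
  by rewrite !mxE; case: eqP => [hs|]; rewrite ?mulr0 //; case: Nh; exists j'.
case: (ltngtP k (ell s)) => [ks|//|/esym/h_onto//].
by rewrite Mid0 // mul0rn.
Qed.

Let Mid_pencil : (Mid *m Alim *m Mid^T = Dh) * (Mid *m Blim *m Mid^T = Lh^T *m Lh).
Proof.
have [_ _ _ D0E] := DL0; split.
  rewrite mul_limit_stiffness // trmx_mul trmxK !mulmxA.
  rewrite -3!(mulmxA (selectmx h)) -D0E mul_selectmx mul_tr_selectmx.
  by apply/matrixP => i j; rewrite !mxE.
rewrite Mid_mass -mulmxA mul_selectmx; congr (_ *m _).
by apply/matrixP => i j; rewrite 2![LHS]mxE MidE !mxE.
Qed.

Let Mid_congr r (W : 'M[R]_(r, n)) S :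
  W *m Mid *m S *m (W *m Mid)^T = W *m (Mid *m S *m Mid^T) *m W^T.
Proof. by rewrite trmx_mul !mulmxA. Qed.

(** The rows of L0^T of index s with ell s < k are annihilated by [limit_mass],
and are orthogonal for A0 to those of the block because L0^T A0 L0 is diagonal;
so they can be adjoined to a subspace where the block form is positive. *)
Lemma limit_pencil_posdef c r (W : 'M[R]_(r, n)) :
  posdefmx (W *m (Dh - c *: (Lh^T *m Lh)) *m W^T) ->
  exists q (V : 'M[R]_(q, m)), q = (#|[pred s | (ell s < k)%N]| + r)%N /\
    posdefmx (V *m (Alim - c *: Blim) *m V^T).
Proof.
move=> Wpos; have [/is_diag_mxP D0diag _ _ D0E] := DL0.
pose lo (i : 'I_#|[pred s | (ell s < k)%N]|) := enum_val i.
have ell_lo i : (ell (lo i) < k)%N by have := enum_valP i; rewrite inE.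
pose Lo := selectmx lo *m L0^T.
have Lo0 i s : (k <= ell s)%N -> Lo i s = 0.
  move=> ks; rewrite /Lo mul_selectmx !mxE Gram_Schmidt_lower0 //.
  exact: leq_trans (ell_lo i) ks.
have Lo_mass : Lo *m Blim = 0.
  rewrite mul_limit_mass; apply/matrixP => i s; rewrite !mxE.
  by case: leqP => // ks; have := Lo0 i s ks; rewrite mxE => ->.
have Lo_stiff b (Y : 'M[R]_(b, m)) : (forall i s, (k < ell s)%N -> Y i s = 0) ->
    Lo *m (Alim - c *: Blim) *m Y^T = Lo *m A0 *m Y^T.
  move=> Y0; rewrite mulmxBr -scalemxAr Lo_mass scaler0 subr0.
  by rewrite mul_limit_stiffness // => i s /ltnW; exact: Lo0.
exists (#|[pred s | (ell s < k)%N]| + r)%N, (col_mx Lo (W *m Mid)); split=> //.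
apply: posdefmx_col_mx.
- by rewrite linearB linearZ /= limit_stiffness_tr // limit_mass_tr.
- rewrite trmx_mul mulmxA Lo_stiff // /Lo /Mid trmx_mul trmxK !mulmxA.
  rewrite -3!(mulmxA (selectmx lo)) -D0E mul_selectmx mul_tr_selectmx.
  rewrite (_ : rowsub lo _ = 0) ?mul0mx //; apply/matrixP => i j; rewrite !mxE.
  rewrite D0diag //; apply: contraTneq (ell_lo i) => /val_inj ->.
  by rewrite ell_h ltnn.
- rewrite Lo_stiff => [|i s /ltnW]; last exact: Lo0.
  apply: posdefmx_congr => //.
  rewrite /row_free /Lo mxrankMfree ?row_free_unit ?Gram_Schmidt_tr_unitmx //.
  exact/selectmx_free/enum_val_inj.
by rewrite Mid_congr mulmxBr mulmxBl -scalemxAr -scalemxAl !Mid_pencil.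
Qed.

(** The coordinate vectors of index s with k < ell s are annihilated by
[limit_stiffness], so that c *: limit_mass - limit_stiffness is c times the
identity on them. *)
Lemma limit_pencil_negdef c r (W : 'M[R]_(r, n)) : 0 < c ->
  posdefmx (W *m (c *: (Lh^T *m Lh) - Dh) *m W^T) ->
  exists q (V : 'M[R]_(q, m)), q = (#|[pred s | (k < ell s)%N]| + r)%N /\
    posdefmx (V *m (c *: Blim - Alim) *m V^T).
Proof.
move=> c0 Wpos.
pose hi (i : 'I_#|[pred s | (k < ell s)%N]|) := enum_val i.
have ell_hi i : (k < ell (hi i))%N by have := enum_valP i; rewrite inE.
have hi0 i s : (ell s <= k)%N -> selectmx hi i s = 0.
  move=> sk; rewrite mxE; case: eqP => // his.
  by have := ell_hi i; rewrite his ltnNge sk.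
have hi_mass : selectmx hi *m Blim = selectmx hi.
  rewrite mul_limit_mass; apply/matrixP => i s; rewrite mxE.
  by case: leqP => // /ltnW/(hi0 i) ->.
have hi_pencil : selectmx hi *m (c *: Blim - Alim) = c *: selectmx hi.
  by rewrite mulmxBr -scalemxAr hi_mass mul_limit_stiffness0 // subr0.
exists (#|[pred s | (k < ell s)%N]| + r)%N, (col_mx (selectmx hi) (W *m Mid)).
split=> //; apply: posdefmx_col_mx.
- by rewrite linearB linearZ /= limit_stiffness_tr // limit_mass_tr.
(* hi *m Mid^T need not vanish: moving the mass matrix onto Mid first kills the
   coordinates of Mid outside the block. *)
- rewrite hi_pencil -hi_mass -scalemxAl -mulmxA -{1}limit_mass_tr -trmx_mul.
  rewrite -mulmxA Mid_mass !trmx_mul trmxK !mulmxA mul_tr_selectmx.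
  rewrite (_ : colsub h _ = 0) ?mul0mx ?scaler0 //.
  by apply/matrixP => i j; rewrite mxE hi0 ?mxE // ell_h.
- rewrite hi_pencil -scalemxAl mul_tr_selectmx.
  rewrite (_ : colsub _ _ = 1%:M) ?scalemx1; first exact: posdefmx_scalar.
  by apply/matrixP => i j; rewrite !mxE (inj_eq enum_val_inj).
by rewrite Mid_congr mulmxBr mulmxBl -scalemxAr -scalemxAl !Mid_pencil.
Qed.

End LimitPencil.

(** * Convergence of matrices and of their definiteness *)

Section Limits.
Variable R : realType.

Lemma cvg_congrmx (T : Type) (F : set_system T) {FF : Filter F} m n
    (S : T -> 'M[R]_m) (S0 : 'M[R]_m) (V : T -> 'M[R]_(n, m)) (V0 : 'M[R]_(n, m)) :
  (forall i j, S x i j @[x --> F] --> S0 i j) ->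
  (forall i j, V x i j @[x --> F] --> V0 i j) ->
  forall i j, (V x *m S x *m (V x)^T) i j @[x --> F] --> (V0 *m S0 *m V0^T) i j.
Proof.
move=> SS0 VV0 i j; rewrite mxE.
under eq_fun do rewrite mxE.
apply: cvg_big => [|t _]; first exact: add_continuous.
under eq_fun do rewrite !mxE.
rewrite !mxE; apply: cvgM => //.
apply: cvg_big => [|s _]; first exact: add_continuous.
exact: cvgM.
Qed.

(** Positivity of the form at a point of the unit sphere persists jointly for
nearby points and parameters; compactness of the sphere makes it uniform, and
homogeneity extends it to all vectors. *)
Lemma near_posdefmx (T : Type) (F : set_system T) {FF : Filter F} n
    (S : T -> 'M[R]_n) (S0 : 'M[R]_n) :
  (forall i j, S x i j @[x --> F] --> S0 i j) -> posdefmx S0 ->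
  \forall x \near F, posdefmx (S x).
Proof.
move=> SS0 S0pos.
pose K : set 'rV[R]_n := [set v | `|v| = 1].
have Kcompact : compact K.
  apply: bounded_closed_compact.
    exists 1; split=> // M M1 v /= ->; exact: ltW.
  rewrite (_ : K = (fun v : 'rV[R]_n => `|v|) @^-1` [set 1]) //.
  by apply: closed_comp => [v _|]; [exact: norm_continuous|exact: closed_eq].
have /compact_near_coveringP/(_ T F (fun x v => 0 < (v *m S x *m v^T) 0 0)) := Kcompact.
move=> /(_ FF) Knear.
have {}Knear : \forall x \near F, K `<=` (fun v => 0 < (v *m S x *m v^T) 0 0).
  apply: Knear => v /= v1.
  have v0 : v != 0 by rewrite -normr_eq0 v1 oner_eq0.
  have := posdefmx_row S0pos v0.
  pose G : set_system ('rV[R]_n * T) := filter_prod (nbhs v) F.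
  have Svcvg : (y.1 *m S y.2 *m y.1^T) 0 0 @[y --> G] --> (v *m S0 *m v^T) 0 0.
    apply: (@cvg_congrmx _ G _ _ _ (S \o snd) S0 fst) => i j.
      by apply: cvg_comp (SS0 i j); exact: cvg_snd.
    apply: (@cvg_comp _ _ _ fst (fun w : 'rV[R]_n => w i j)); first exact: cvg_fst.
    exact: coord_continuous.
  by move=> vS0v; exact: (cvgr_gt _ Svcvg).
near=> x => v v0.
have w1 : K (`|v^T|^-1 *: v^T).
  rewrite /K /= normrZ normfV normr_id mulVf // normr_eq0.
  by rewrite -trmx0 (inj_eq (@trmx_inj _ _ _)).
have /(_ _ w1) : K `<=` (fun v => 0 < (v *m S x *m v^T) 0 0) by near: x.
rewrite /= linearZ /= trmxK -!scalemxAl -scalemxAr !mxE.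
set a := `|_|; have a0 : 0 < a^-1.
  rewrite invr_gt0 normr_gt0.
  by rewrite -trmx0 (inj_eq (@trmx_inj _ _ _)).
by rewrite !pmulr_rgt0.
Unshelve. all: by end_near. Qed.

Lemma cvg_exprn_right0 n : (e : R) ^+ n @[e --> 0^'+] --> ((n == 0)%N%:R : R).
Proof.
by rewrite -expr0n; apply: cvg_at_right_filter; exact: exprn_continuous.
Qed.

Lemma cvg_div_of_littleo (f : R -> R) (a : R) n :
  ((f : R -> R^o) = (fun e : R => a * e ^+ n : R^o)
    +o_ (0^'+) (fun e : R => e ^+ n : R^o)) ->
  f e / e ^+ n @[e --> 0^'+] --> a.
Proof.
move=> /eqaddoP fa; apply/cvgrPdist_le => eps eps0.
near=> e.
have e0 : 0 < e by near: e; exact: nbhs_right_gt.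
have en0 : 0 < e ^+ n by rewrite exprn_gt0.
have : `|f e - a * e ^+ n| <= eps * `|e ^+ n| by near: e; exact: fa.
rewrite distrC -ler_pdivrMr ?normr_gt0 ?gt_eqF // -normfV -normrM.
by rewrite mulrBl mulfK // gt_eqF.
Unshelve. all: by end_near. Qed.

End Limits.

(** * Rescaling around the exponent k *)

Section ScaledPencil.
Variables (R : realType) (m : nat) (A B : R -> 'M[R]_m) (A0 : 'M[R]_m).
Variable ell : 'I_m -> nat.
Hypothesis A_cvg : forall s t,
  A e s t / e ^+ (ell s + ell t) @[e --> 0^'+] --> A0 s t.
Hypothesis B_cvg : forall s t, B e s t @[e --> 0^'+] --> ((s == t)%:R : R).
Variable k : nat.

Definition block_scaling (e : R) : 'M[R]_m :=
  diag_mx (\row_s (e ^+ minn (ell s) k)^-1).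

Local Notation F := block_scaling.

Lemma block_scaling_tr e : (F e)^T = F e.
Proof. by rewrite tr_diag_mx. Qed.

(** With truncated subtraction, ell s = min(ell s, k) + (ell s - k) and
k = min(ell s, k) + (k - ell s), so scaling turns A e s t into
A0 s t + o(1) times e ^ ((ell s - k) + (ell t - k)), and e^(2k) B e s t into
B e s t times e ^ ((k - ell s) + (k - ell t)); these powers tend to 1 or 0
according to whether their exponents vanish. *)
Lemma cvg_scaled_pencil a b s t :
  (F e *m (a *: A e + (b * e ^+ (2 * k)) *: B e) *m (F e)^T) s t @[e --> 0^'+]
    --> (a *: limit_stiffness ell A0 k + b *: limit_mass R ell k) s t.
Proof.
pose G e := a * (A e s t / e ^+ (ell s + ell t) *
                   e ^+ ((ell s - k) + (ell t - k))) +
            b * (B e s t * e ^+ ((k - ell s) + (k - ell t))).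
have FG : {near 0^'+, G =1
    (fun e => (F e *m (a *: A e + (b * e ^+ (2 * k)) *: B e) *m (F e)^T) s t)}.
  near=> e.
  have e0 : e != 0 by rewrite gt_eqF //; near: e; exact: nbhs_right_gt.
  have eu n : e ^+ n != 0 by rewrite expf_neq0.
  rewrite block_scaling_tr /F mul_diag_mx mul_mx_diag !mxE.
  have es : (ell s = minn (ell s) k + (ell s - k))%N by lia.
  have et : (ell t = minn (ell t) k + (ell t - k))%N by lia.
  have ek : (2 * k = minn (ell s) k + (k - ell s) + (minn (ell t) k + (k - ell t)))%N by lia.
  rewrite /G [in X in _ / X]es [in X in _ / X]et ek !exprD.
  have := eu (minn (ell s) k); have := eu (minn (ell t) k).
  have := eu (ell s - k)%N; have := eu (ell t - k)%N.
  by move=> *; field; repeat (apply/andP; split).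
apply: cvg_trans (near_eq_cvg FG) _.
rewrite !mxE; apply: cvgD; apply: cvgMr.
  have -> : A0 s t *+ ((ell s <= k) && (ell t <= k))%N =
      A0 s t * (ell s - k + (ell t - k) == 0)%N%:R.
    by rewrite addn_eq0 !subn_eq0 mulr_natr.
  by apply: cvgM => //; exact: cvg_exprn_right0.
have -> : ((s == t) && (k <= ell s))%N%:R =
    (s == t)%:R * (k - ell s + (k - ell t) == 0)%N%:R :> R.
  rewrite addn_eq0 !subn_eq0; case: eqP => [->|_]; last by rewrite mul0r.
  by rewrite andbb mul1r.
by apply: cvgM => //; exact: cvg_exprn_right0.
Unshelve. all: by end_near. Qed.

End ScaledPencil.

Section NearPencil.
Variables (R : realType) (m : nat) (A B : R -> 'M[R]_m) (A0 : 'M[R]_m).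
Variable ell : 'I_m -> nat.
Hypothesis A_cvg : forall s t,
  A e s t / e ^+ (ell s + ell t) @[e --> 0^'+] --> A0 s t.
Hypothesis B_cvg : forall s t, B e s t @[e --> 0^'+] --> ((s == t)%:R : R).
Variable k : nat.

(** Positive subspaces of the limit pencil remain positive for the original
pencil, at the threshold scaled by e^(2k). *)
Lemma near_posdef_pencil a b q (V : 'M[R]_(q, m)) :
  posdefmx (V *m (a *: limit_stiffness ell A0 k + b *: limit_mass R ell k) *m V^T) ->
  \forall e \near 0^'+, exists V' : 'M[R]_(q, m),
    posdefmx (V' *m (a *: A e + (b * e ^+ (2 * k)) *: B e) *m V'^T).
Proof.
move=> Vpos; pose X e := a *: A e + (b * e ^+ (2 * k)) *: B e.
pose S e := V *m (block_scaling ell k e *m X e *m (block_scaling ell k e)^T) *m V^T.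
have : \forall e \near 0^'+, posdefmx (S e).
  apply: (near_posdefmx _ Vpos).
  by apply: cvg_congrmx => [s t|s t]; [exact: cvg_scaled_pencil|exact: cvg_cst].
apply: filterS => e Spos; exists (V *m block_scaling ell k e).
by move: Spos; rewrite /S trmx_mul !mulmxA.
Qed.

End NearPencil.

(** * The pencil of a diagonal block *)

Section GramSchmidtBlock.
Variables (R : realFieldType) (m : nat) (A0 D0 L0 : 'M[R]_m).
Hypotheses (A0sym : A0^T = A0) (A0pos : posdefmx A0).
Hypothesis DL0 : Gram_Schmidt_pair A0 D0 L0.
Variables (n N : nat) (h : 'I_n -> 'I_m).
Hypothesis hE : forall j, h j = (N + j)%N :> nat.

Lemma block_inj : injective h.
Proof. by move=> i j /(congr1 (@nat_of_ord m)); rewrite !hE => /addnI/val_inj. Qed.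

Lemma Gram_Schmidt_block_posdef : posdefmx (mxsub h h D0).
Proof.
have -> : mxsub h h D0 = selectmx R h *m D0 *m (selectmx R h)^T.
  by rewrite mul_selectmx mul_tr_selectmx; apply/matrixP => i j; rewrite !mxE.
apply: posdefmx_congr; last exact/selectmx_free/block_inj.
have [_ _ _ ->] := DL0; rewrite -{2}[L0]trmxK; apply: posdefmx_congr => //.
by rewrite row_free_unit (Gram_Schmidt_tr_unitmx DL0).
Qed.

Lemma Gram_Schmidt_block_tr : (mxsub h h D0)^T = mxsub h h D0.
Proof.
have [_ _ _ ->] := DL0.
by rewrite trmx_mxsub !trmx_mul A0sym trmxK mulmxA.
Qed.

(** h is increasing, so the block of L0 is again lower triangular with unit
diagonal. *)
Lemma Gram_Schmidt_block_mass_posdef :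
  posdefmx ((mxsub h h L0)^T *m mxsub h h L0).
Proof.
have [_ /is_trig_mxP L0trig L01 _] := DL0.
rewrite -{2}[mxsub h h L0]trmxK -[X in X *m _]mulmx1.
apply: posdefmx_congr; first exact: posdefmx_scalar.
rewrite row_free_unit unitmx_tr unitmxE det_trig; last first.
  by apply/is_trig_mxP => i j ij; rewrite mxE L0trig // !hE ltn_add2l.
by rewrite big1 ?unitr1 // => i _; rewrite mxE.
Qed.

End GramSchmidtBlock.

(** * Asymptotics of the eigenvalues of one block *)

Section BlockAsymptotics.
Variables (R : realType) (m : nat) (A B : R -> 'M[R]_m) (A0 : 'M[R]_m).
Variable ell : 'I_m -> nat.
Hypothesis A_sym : \forall e \near 0^'+, (A e)^T = A e.
Hypothesis B_sym : \forall e \near 0^'+, (B e)^T = B e.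
Hypothesis ell_noninc : forall s t : 'I_m, (s <= t)%N -> (ell t <= ell s)%N.
Hypotheses (A0sym : A0^T = A0) (A0pos : posdefmx A0).
Hypothesis A_cvg : forall s t,
  A e s t / e ^+ (ell s + ell t) @[e --> 0^'+] --> A0 s t.
Hypothesis B_cvg : forall s t, B e s t @[e --> 0^'+] --> ((s == t)%:R : R).
Variable mu : R -> 'I_m -> R.
Hypothesis mu_eig : \forall e \near 0^'+, ordered_eigenvalues (A e) (B e) (mu e).
Variables D0 L0 : 'M[R]_m.
Hypothesis DL0 : Gram_Schmidt_pair A0 D0 L0.
Variables (k n : nat) (h : 'I_n -> 'I_m).
Hypothesis ell_h : forall j, ell (h j) = k.
Hypothesis h_onto : forall s, ell s = k -> exists j, s = h j.
Hypothesis hE : forall j, h j = (#|[pred s | (k < ell s)%N]| + j)%N :> nat.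
Hypothesis m_split :
  (m = #|[pred s | (k < ell s)%N]| + n + #|[pred s | (ell s < k)%N]|)%N.
Variable muhat : 'I_n -> R.
Let Dh := mxsub h h D0.
Let Qh := (mxsub h h L0)^T *m mxsub h h L0.
Hypothesis muhat_eig : ordered_eigenvalues Dh Qh muhat.

Let h_inj : injective h := block_inj hE.
Let Dsym : Dh^T = Dh := Gram_Schmidt_block_tr A0sym DL0 h.
Let Dpos : posdefmx Dh := Gram_Schmidt_block_posdef A0pos DL0 hE.
Let Qpos : posdefmx Qh := Gram_Schmidt_block_mass_posdef DL0 hE.
Let Qsym : Qh^T = Qh. Proof. by rewrite trmx_mul trmxK. Qed.

Lemma near_B_posdef : \forall e \near 0^'+, posdefmx (B e).
Proof.
apply: (near_posdefmx (S0 := 1%:M)); last exact: posdefmx_scalar.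
by move=> s t; rewrite mxE.
Qed.

(** Ensures that every threshold c > muhat j is positive, as
[limit_pencil_negdef] requires. *)
Lemma muhat_gt0 j : 0 < muhat j.
Proof.
have [muhat_ndecr muhatP] := muhat_eig.
rewrite (sorted_gtE muhat_ndecr) (leq_trans (leq_subr _ _)) //.
apply: (leq_card_eigenvalues_gt Dsym Qsym Qpos muhatP (V := 1%:M)).
by rewrite mul1mx trmx1 mulmx1 scale0r subr0.
Qed.

(** The form limit_stiffness - c *: limit_mass is negative definite on a subspace
whose dimension is the number of coordinates with k < ell plus the number of
muhat below c; this exceeds the index h j. *)
Lemma near_eigenvalue_lt j c : muhat j < c ->
  \forall e \near 0^'+, mu e (h j) < c * e ^+ (2 * k).
Proof.
move=> jc; have c0 : 0 < c := lt_trans (muhat_gt0 j) jc.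
have [muhat_ndecr muhatP] := muhat_eig.
have [r [W [rE Wpos]]] := posdef_eigenvalues_lt Dsym Qsym Qpos muhatP c.
have [q [V [qE]]] := limit_pencil_negdef ell_noninc A0sym DL0
  ell_h h_onto h_inj c0 Wpos.
rewrite (addrC (c *: _)) -scaleN1r.
move=> /(near_posdef_pencil A_cvg B_cvg) Vnear.
near=> e.
have [mu_ndecr muP] : ordered_eigenvalues (A e) (B e) (mu e) by near: e.
rewrite (sorted_ltE mu_ndecr).
have [V' V'pos] : exists V' : 'M[R]_(q, m), posdefmx
    (V' *m (-1 *: A e + (c * e ^+ (2 * k)) *: B e) *m V'^T) by near: e.
apply: (@leq_trans q).
  by rewrite hE qE ltn_add2l rE -(sorted_ltE muhat_ndecr).
have Asym : (A e)^T = A e by near: e.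
have Bsym : (B e)^T = B e by near: e.
have Bpos : posdefmx (B e) by near: e; exact: near_B_posdef.
apply: (leq_card_eigenvalues_lt Asym Bsym Bpos muP (V := V')).
by rewrite addrC -scaleN1r.
Unshelve. all: by end_near. Qed.

(** The same form is positive definite on a subspace whose dimension is the
number of muhat above c plus the number of coordinates with ell < k; this is at
least m - h j. *)
Lemma near_eigenvalue_gt j c : c < muhat j ->
  \forall e \near 0^'+, c * e ^+ (2 * k) < mu e (h j).
Proof.
move=> cj; have [muhat_ndecr muhatP] := muhat_eig.
have [r [W [rE Wpos]]] := posdef_eigenvalues_gt Dsym Qsym Qpos muhatP c.
have [q [V [qE]]] := limit_pencil_posdef ell_noninc A0sym A0pos DL0
  ell_h h_onto h_inj Wpos.
rewrite -scaleNr -[X in X + _]scale1r.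
move=> /(near_posdef_pencil A_cvg B_cvg) Vnear.
near=> e.
have [mu_ndecr muP] : ordered_eigenvalues (A e) (B e) (mu e) by near: e.
rewrite (sorted_gtE mu_ndecr).
have [V' V'pos] : exists V' : 'M[R]_(q, m), posdefmx
    (V' *m (1 *: A e + (- c * e ^+ (2 * k)) *: B e) *m V'^T) by near: e.
apply: (@leq_trans q).
  have : (n - j <= r)%N by rewrite rE -(sorted_gtE muhat_ndecr).
  by rewrite hE qE; have := m_split; lia.
have Asym : (A e)^T = A e by near: e.
have Bsym : (B e)^T = B e by near: e.
have Bpos : posdefmx (B e) by near: e; exact: near_B_posdef.
apply: (leq_card_eigenvalues_gt Asym Bsym Bpos muP (V := V')).
by rewrite -scaleNr -mulNr -[A e]scale1r.
Unshelve. all: by end_near. Qed.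

Lemma block_eigenvalue_asymptotics j :
  (fun e : R => mu e (h j) : R^o) = (fun e : R => muhat j * e ^+ (2 * k) : R^o)
    +o_ (0^'+) (fun e : R => e ^+ (2 * k) : R^o).
Proof.
apply/eqaddoP => eps eps0.
have lt1 : muhat j < muhat j + eps by rewrite ltrDl.
have lt2 : muhat j - eps < muhat j by rewrite ltrBlDr ltrDl.
near=> e.
have e0 : 0 < e by near: e; exact: nbhs_right_gt.
have e2k : 0 < e ^+ (2 * k) by rewrite exprn_gt0.
change (`|mu e (h j) - muhat j * e ^+ (2 * k)| <= eps * `|e ^+ (2 * k)|).
rewrite [X in _ <= _ * X]gtr0_norm // ler_distl -mulrDl -mulrBl.
apply/andP; split; apply: ltW; near: e.
  exact: near_eigenvalue_gt.
exact: near_eigenvalue_lt.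
Unshelve. all: by end_near. Qed.

End BlockAsymptotics.

(** * The indices of a block *)

Section BlockIndices.
Variables (m : nat) (ell : 'I_m -> nat).
Hypothesis ell_noninc : forall s t : 'I_m, (s <= t)%N -> (ell t <= ell s)%N.
Variables (p : nat) (k mult : 'I_p -> nat).
Hypothesis k_decr : forall i j : 'I_p, (i < j)%N -> (k j < k i)%N.
Hypothesis k_values : forall x : nat, (exists i, k i = x) <-> (exists s, ell s = x).
Hypothesis mult_card : forall i, mult i = #|[set s : 'I_m | ell s == k i]%SET|.
Hypothesis mult_sum : (\sum_i mult i)%N = m.
Variable i : 'I_p.

Lemma ltn_block_value i' : (k i < k i')%N = (i' < i)%N.
Proof.
case: (ltngtP i' i) => [/k_decr //|/k_decr|/val_inj->]; last by rewrite ltnn.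
by move=> /ltnW; rewrite leqNgt => /negPf.
Qed.

(** The values above k i are the k i' with i' < i, each taken mult i' times;
hence the i-th block starts right after the indices with k i < ell. *)
Lemma card_gt_block_value :
  #|[pred s | (k i < ell s)%N]| = (\sum_(i' < p | (i' < i)%N) mult i')%N.
Proof.
have /choice[f fE] s : exists i', k i' = ell s by apply/k_values; exists s.
rewrite -sum1_card (partition_big f (fun i' => i' < i)%N) /= => [|s].
  apply: eq_bigr => i' i'i; rewrite mult_card -sum1_card; apply: eq_bigl => s.
  rewrite !inE -fE ltn_block_value; apply/andP/eqP => [[_ /eqP->] //|kk].
  suff -> : f s = i' by [].
  apply/val_inj; case: (ltngtP (f s) i') => // /k_decr; by rewrite kk ltnn.
by rewrite inE -fE ltn_block_value.
Qed.

Lemma card_ge_block_value :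
  #|[pred s | (k i <= ell s)%N]| = (#|[pred s | (k i < ell s)%N]| + mult i)%N.
Proof.
rewrite mult_card -cardUI [X in (_ + X)%N]eq_card0 ?addn0 => [|s]; last first.
  by rewrite !inE; case: ltngtP.
by apply: eq_card => s; rewrite !inE; case: ltngtP.
Qed.

Lemma block_index_card (j : 'I_(mult i)) :
  block_index mult_sum j = (#|[pred s | (k i < ell s)%N]| + j)%N :> nat.
Proof. by rewrite block_indexE card_gt_block_value. Qed.

Lemma ell_gtE s : (k i < ell s)%N = (s < #|[pred s | (k i < ell s)%N]|)%N.
Proof.
apply: (@initial_segmentE m (fun s => k i < ell s)%N) => s' t st.
by move=> /leq_trans; apply; exact: ell_noninc.
Qed.

Lemma ell_geE s : (k i <= ell s)%N = (s < #|[pred s | (k i < ell s)%N]| + mult i)%N.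
Proof.
rewrite -card_ge_block_value.
apply: (@initial_segmentE m (fun s => k i <= ell s)%N) => s' t st.
by move=> /leq_trans; apply; exact: ell_noninc.
Qed.

Lemma ell_block_index (j : 'I_(mult i)) : ell (block_index mult_sum j) = k i.
Proof.
apply/eqP; rewrite eqn_leq leqNgt ell_gtE ell_geE block_index_card.
by rewrite ltn_add2l ltn_ord -leqNgt leq_addr.
Qed.

Lemma block_index_onto s : ell s = k i -> exists j : 'I_(mult i), s = block_index mult_sum j.
Proof.
move=> sk; have := ell_gtE s; rewrite sk ltnn => /esym/negbT; rewrite -leqNgt => gs.
have := ell_geE s; rewrite sk leqnn => /esym sg.
have lt_mult : (s - #|[pred s | (k i < ell s)%N]| < mult i)%N by rewrite ltn_subLR.
by exists (Ordinal lt_mult); apply/ord_inj; rewrite block_index_card /= subnKC.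
Qed.

Lemma card_block_split :
  (m = #|[pred s | (k i < ell s)%N]| + mult i + #|[pred s | (ell s < k i)%N]|)%N.
Proof.
rewrite -card_ge_block_value -[LHS]card_ord -(cardC [pred s | (k i <= ell s)%N]).
by congr (_ + _)%N; apply: eq_card => s; rewrite !inE ltnNge.
Qed.

End BlockIndices.

(** * Asymptotics of all eigenvalues *)

Theorem proposition16 (R : realType) (m : nat)
  (A B : R -> 'M[R]_m) (A0 : 'M[R]_m) (ell : 'I_m -> nat)
  (A_sym : \forall e \near 0^'+, A e \is symmetricmx)
  (B_sym : \forall e \near 0^'+, B e \is symmetricmx)
  (ell_gt0 : forall s, (0 < ell s)%N)
  (ell_noninc : forall s t : 'I_m, (s <= t)%N -> (ell t <= ell s)%N)
  (A0_sym : A0 \is symmetricmx) (A0_posdef : posdefmx A0)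
  (A_asym : forall s t : 'I_m,
     (fun e : R => A e s t : R^o) = (fun e : R => A0 s t * e ^+ (ell s + ell t) : R^o)
       +o_ (0^'+) (fun e : R => e ^+ (ell s + ell t) : R^o))
  (B_asym : forall s t : 'I_m,
     (fun e : R => B e s t : R^o) = (fun e : R => (s == t)%:R : R^o)
       +o_ (0^'+) (fun e : R => 1 : R^o))
  (mu : R -> 'I_m -> R)
  (mu_eig : \forall e \near 0^'+, ordered_eigenvalues (A e) (B e) (mu e))
  (p : nat) (k mult : 'I_p -> nat)
  (k_decr : forall i j : 'I_p, (i < j)%N -> (k j < k i)%N)
  (k_values : forall x : nat, (exists i, k i = x) <-> (exists s, ell s = x))
  (mult_card : forall i, mult i = #|[set s : 'I_m | ell s == k i]%SET|)
  (mult_sum : (\sum_i mult i)%N = m)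
  (D0 L0 : 'M[R]_m) (DL0_GS : Gram_Schmidt_pair A0 D0 L0)
  (muhat : forall i : 'I_p, 'I_(mult i) -> R)
  (muhat_eig : forall i : 'I_p,
     let Di := diag_block mult_sum D0 i in
     let Li := diag_block mult_sum L0 i in
     let Qi := Li^T *m Li in
     ordered_eigenvalues Di Qi (@muhat i)) :
  forall (i : 'I_p) (j : 'I_(mult i)),
    (fun e : R => mu e (block_index mult_sum j) : R^o) =
      (fun e : R => muhat i j * e ^+ (2 * k i) : R^o)
        +o_ (0^'+) (fun e : R => e ^+ (2 * k i) : R^o).
Proof.
have trnear (M : R -> 'M[R]_m) : (\forall e \near 0^'+, M e \is symmetricmx) ->
    \forall e \near 0^'+, (M e)^T = M e.
  by apply: filterS => e; exact: symmetricmx_tr.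
have A_cvg s t := cvg_div_of_littleo (A_asym s t).
have B_cvg s t : B e s t @[e --> 0^'+] --> ((s == t)%:R : R).
  rewrite (_ : (fun e => B e s t) = (fun e => B e s t / e ^+ 0)); last first.
    by apply/funext => e; rewrite expr0 divr1.
  apply: cvg_div_of_littleo; move: (B_asym s t).
  rewrite (_ : (fun e : R => _ * e ^+ 0) = (fun=> (s == t)%:R)) //.
  by apply/funext => e; rewrite expr0 mulr1.
move=> i j.
apply: (block_eigenvalue_asymptotics (trnear _ A_sym) (trnear _ B_sym)
  ell_noninc (symmetricmx_tr A0_sym) A0_posdef A_cvg B_cvg mu_eig DL0_GS
  _ _ _ _ (muhat_eig i)).
- exact: ell_block_index.
- exact: block_index_onto.
- exact: block_index_card.
- exact: card_block_split.
Qed.
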